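(* For every integer $k \geq 1$, there are, up to isomorphism, only finitely many $k$-vertex-critical $(P_5,\text{cricket})$-free graphs.
   Context: All graphs are finite and simple. For graphs $G, F_1, F_2$, $G$ is $(F_1,F_2)$-free if neither $F_1$ nor $F_2$ is (isomorphic to) an induced subgraph of $G$. $\chi(G)$ denotes the chromatic number of $G$. A graph $G$ is $k$-vertex-critical if $\chi(G)=k$ but $\chi(G-v)<k$ for every vertex $v\in V(G)$. $P_5$ is the path on $5$ vertices. The cricket is the $5$-vertex graph obtained from a triangle by adding two pendant vertices (new vertices of degree one, nonadjacent to each other), both adjacent to the same vertex of the triangle. *)

(* Defs.v *)
From mathcomp Require Import all_boot.

Set Implicit Arguments.
Unset Strict Implicit.
Unset Printing Implicit Defensive.

Record sgraph := SGraph {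
  vertex :> finType;
  adj : rel vertex;
  adj_sym : symmetric adj;
  adj_irrefl : irreflexive adj }.

Definition isomorphic (G H : sgraph) : Prop :=
  exists2 f : G -> H, bijective f & forall x y : G, adj (f x) (f y) = adj x y.

Section Induced.
Variables (G : sgraph) (S : {set G}).

Definition induced_adj : rel {x : G | x \in S} :=
  fun x y => adj (val x) (val y).

Lemma induced_adj_sym : symmetric induced_adj.
Proof. by move=> x y; apply: adj_sym. Qed.

Lemma induced_adj_irrefl : irreflexive induced_adj.
Proof. by move=> x; apply: adj_irrefl. Qed.

Definition induced : sgraph := SGraph induced_adj_sym induced_adj_irrefl.
End Induced.

Definition del_vertex (G : sgraph) (v : G) : sgraph := induced [set~ v].

Definition induced_in (F G : sgraph) : Prop :=
  exists S : {set G}, isomorphic F (induced S).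

Definition free2 (F1 F2 G : sgraph) : Prop :=
  ~ induced_in F1 G /\ ~ induced_in F2 G.

Definition colorable (G : sgraph) (c : nat) : bool :=
  [exists f : {ffun G -> 'I_c},
    [forall x : G, forall y : G, adj x y ==> (f x != f y)]].

Lemma colorable_ex (G : sgraph) : exists c, colorable G c.
Proof.
exists #|G|; apply/existsP; exists [ffun x => enum_rank x].
apply/forallP=> x; apply/forallP=> y; apply/implyP; rewrite !ffunE.
by apply: contraTneq => /enum_rank_inj ->; rewrite adj_irrefl.
Qed.

Definition chromatic_number (G : sgraph) : nat := ex_minn (colorable_ex G).

Definition vertex_critical (k : nat) (G : sgraph) : Prop :=
  chromatic_number G = k /\
  forall v : G, chromatic_number (del_vertex v) < k.

Section EdgeList.
Variables (n : nat) (es : seq (nat * nat)).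

(* Loops (i, i) in the list are ignored. *)
Definition edge_list_adj : rel 'I_n := fun x y =>
  (x != y) && (((x : nat, y : nat) \in es) || ((y : nat, x : nat) \in es)).

Lemma edge_list_adj_sym : symmetric edge_list_adj.
Proof. by move=> x y; rewrite /edge_list_adj eq_sym orbC. Qed.

Lemma edge_list_adj_irrefl : irreflexive edge_list_adj.
Proof. by move=> x; rewrite /edge_list_adj eqxx. Qed.

Definition edge_list_graph : sgraph :=
  SGraph edge_list_adj_sym edge_list_adj_irrefl.
End EdgeList.

Definition P5 : sgraph :=
  edge_list_graph 5 [:: (0, 1); (1, 2); (2, 3); (3, 4)].

(* Triangle 0, 1, 2 with pendant vertices 3 and 4 attached to 0. *)
Definition cricket : sgraph :=
  edge_list_graph 5 [:: (0, 1); (0, 2); (1, 2); (0, 3); (0, 4)].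

Definition finitely_many_up_to_iso (P : sgraph -> Prop) : Prop :=
  exists (n : nat) (H : 'I_n -> sgraph),
    forall G : sgraph, P G -> exists i : 'I_n, isomorphic G (H i).

(* Main.v *)
(** In a k-vertex-critical graph G no neighbourhood contains another one.  Let
    S be a large colour class.  By P5-freeness the traces on S of two
    nonadjacent vertices are nested or disjoint, and cricket-freeness makes
    intersecting traces of adjacent vertices differ by at most one vertex on
    each side.  Hence a smallest trace among the neighbours of s in S has at
    most k + 1 elements: for each other element a of it, some neighbour of s
    misses a, and these neighbours form a clique.  Laminarity within one
    colour class then yields a large induced matching.  But in a connected
    P5- and cricket-free graph, where all distances are at most 3, the ways to
    join one fixed matching edge to the others bound the matching by 5k + 1
    edges, hence |G| is bounded. *)

Require Import Defs.
From mathcomp Require Import all_boot.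

Set Implicit Arguments.
Unset Strict Implicit.
Unset Printing Implicit Defensive.

(** * Forbidden induced subgraphs as adjacency patterns *)

Lemma induced_in_inj (F G : sgraph) (f : F -> G) :
  injective f -> (forall x y, adj (f x) (f y) = adj x y) -> induced_in F G.
Proof.
move=> f_inj f_adj; exists [set f x | x in F].
have fP x : f x \in [set f x | x in F] by apply: imset_f.
exists (fun x => exist _ (f x) (fP x) : induced [set f x | x in F]).
  apply: inj_card_bij; first by move=> x y [] /f_inj.
  by rewrite card_sig card_imset.
by move=> x y; rewrite -f_adj.
Qed.

(** The adjacency pattern alone forces five distinct vertices, since no two vertices of [P5] have
    the same neighbourhood. *)
Definition P5_avoiding (G : sgraph) := forall a b c d e : G,
  adj a b -> adj b c -> adj c d -> adj d e ->
  [|| adj a c, adj a d, adj a e, adj b d, adj b e | adj c e].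

(** Here [x != y] has to be stated: the two pendant vertices have the same neighbourhood. *)
Definition cricket_avoiding (G : sgraph) := forall c a b x y : G,
  adj c a -> adj c b -> adj a b -> adj c x -> adj c y -> x != y ->
  [|| adj a x, adj a y, adj b x, adj b y | adj x y].

Lemma P5_avoidingP (G : sgraph) : ~ induced_in P5 G -> P5_avoiding G.
Proof.
move=> noP5 a b c d e ab bc cd de; apply/negP=> /negP.
rewrite !negb_or => /and5P[ac ad ae bd /andP[be ce]]; apply: noP5.
have irr := @adj_irrefl G; have sym := @adj_sym G.
have [[ba cb] [dc ed]] : (adj b a /\ adj c b) /\ (adj d c /\ adj e d).
  by do ![split]; rewrite sym.
pose f (i : P5) := nth a [:: a; b; c; d; e] i.
have f_adj x y : adj (f x) (f y) = adj x y.
  case: x => [[|[|[|[|[|//]]]]] ?]; case: y => [[|[|[|[|[|//]]]]] ?];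
    rewrite /f /= /edge_list_adj /= ?irr //; apply/negbTE;
    by rewrite // sym.
apply: (induced_in_inj _ f_adj).
(* Vertices with equal images have the same neighbours in [P5], hence coincide. *)
move=> x y fxy; apply/eqP.
have fN z : adj x z = adj y z by rewrite -!f_adj fxy.
have := fN (@Ordinal 5 0 isT); have := fN (@Ordinal 5 1 isT).
have := fN (@Ordinal 5 2 isT); have := fN (@Ordinal 5 3 isT).
have := fN (@Ordinal 5 4 isT); clear fN; move: x y {fxy}.
by case=> [[|[|[|[|[|//]]]]] ?]; case=> [[|[|[|[|[|//]]]]] ?].
Qed.

Lemma cricket_avoidingP (G : sgraph) :
  ~ induced_in cricket G -> cricket_avoiding G.
Proof.
move=> nocr c a b x y ca cb ab cx cy xy; apply/negP=> /negP.
rewrite !negb_or => /and5P[ax ay bx byy nxy]; apply: nocr.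
have irr := @adj_irrefl G; have sym := @adj_sym G.
have [[ac bc] [ba [xc yc]]] :
  (adj a c /\ adj b c) /\ (adj b a /\ (adj x c /\ adj y c)).
  by do ![split]; rewrite sym.
pose f (i : cricket) := nth a [:: c; a; b; x; y] i.
have f_adj u v : adj (f u) (f v) = adj u v.
  case: u => [[|[|[|[|[|//]]]]] ?]; case: v => [[|[|[|[|[|//]]]]] ?];
    rewrite /f /= /edge_list_adj /= ?irr //; apply/negbTE;
    by rewrite // sym.
apply: (induced_in_inj _ f_adj).
move=> u v fuv; apply/eqP.
have fN z : adj u z = adj v z by rewrite -!f_adj fuv.
have := fN (@Ordinal 5 0 isT); have := fN (@Ordinal 5 1 isT).
have := fN (@Ordinal 5 2 isT); have := fN (@Ordinal 5 3 isT).
have := fN (@Ordinal 5 4 isT); clear fN; move: u v fuv.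
case=> [[|[|[|[|[|//]]]]] ?]; case=> [[|[|[|[|[|//]]]]] ?] //=;
  by rewrite /f /= => exy; move: xy; rewrite exy eqxx.
Qed.

(** * Colourings and vertex-critical graphs *)

Definition proper (G : sgraph) (C : eqType) (f : G -> C) :=
  forall x y, adj x y -> f x != f y.

Lemma colorableP (G : sgraph) c :
  reflect (exists f : G -> 'I_c, proper f) (colorable G c).
Proof.
apply: (iffP existsP) => [[f /forallP fP]|[f fP]].
  by exists f => x y xy; move/forallP: (fP x) => /(_ y) /implyP; apply.
exists [ffun x => f x]; apply/forallP=> x; apply/forallP=> y.
by apply/implyP=> xy; rewrite !ffunE fP.
Qed.

Lemma chromatic_numberP (G : sgraph) : colorable G (chromatic_number G).
Proof. by rewrite /chromatic_number; case: ex_minnP. Qed.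

Lemma chromatic_number_le (G : sgraph) c :
  colorable G c -> chromatic_number G <= c.
Proof. by rewrite /chromatic_number; case: ex_minnP => n _; apply. Qed.

Section Critical.
Variables (k : nat) (G : sgraph).
Hypotheses (k_gt0 : 0 < k) (Gcrit : vertex_critical k G).

Lemma critical_coloring : exists f : G -> 'I_k, proper f.
Proof. by apply/colorableP; rewrite -Gcrit.1 chromatic_numberP. Qed.

Lemma critical_no_coloring (f : G -> nat) :
  proper f -> ~ (forall x, f x < k.-1).
Proof.
move=> f_proper f_lt.
have : chromatic_number G <= k.-1.
  apply: chromatic_number_le; apply/colorableP.
  by exists (fun x => Ordinal (f_lt x)) => x y /f_proper.
by rewrite Gcrit.1 leqNgt prednK // leqnn.
Qed.

Lemma critical_del_coloring (v : G) : exists f : G -> nat,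
  (forall x, x != v -> f x < k.-1) /\
  (forall x y, x != v -> y != v -> adj x y -> f x != f y).
Proof.
have /colorableP [f fP] := chromatic_numberP (del_vertex v).
have lt_k := Gcrit.2 v; rewrite -[k]prednK // ltnS in lt_k.
(* The default 0 is taken only at the deleted vertex [v]. *)
pose g x := oapp (fun u : del_vertex v => val (f u)) 0 (insub x).
have gE x (xv : x != v) :
    {u : del_vertex v | val u = x & g x = f u}.
  have xP : x \in [set~ v] by rewrite !inE.
  by exists (Sub x xP); rewrite // /g insubT.
exists g; split=> [x /gE [u _ ->]|x y /gE [u <- ->] /gE [w <- ->] uw].
  by apply: leq_trans lt_k.
exact: (fP u w).
Qed.

(** If every neighbour of [x] were a neighbour of [y], giving [x] the colour of [y] would extend a
    [k.-1]-colouring of G - x to G. *)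
Lemma critical_incomparable (x y : G) : x != y ->
  exists2 z, adj x z & ~~ adj y z.
Proof.
move=> xy; case: (pickP [pred z | adj x z && ~~ adj y z]).
  by move=> z /andP[]; exists z.
move=> sub_xy; have sub z : adj x z -> adj y z.
  by move=> xz; move/negbT: (sub_xy z); rewrite /= xz negbK.
have [f [f_lt f_proper]] := critical_del_coloring x.
pose g z := if z == x then f y else f z.
case: (@critical_no_coloring g) => [u v uv|u]; last first.
  by rewrite /g; case: eqVneq => // [_|/f_lt //]; rewrite f_lt // eq_sym.
have yx : y != x by rewrite eq_sym.
rewrite /g; have [ux|ux] := eqVneq u x; have [vx|vx] := eqVneq v x.
- by move: uv; rewrite ux vx adj_irrefl.
- by apply: f_proper => //; apply: sub; rewrite -ux.
- by apply: f_proper => //; rewrite adj_sym sub // -vx adj_sym.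
- exact: f_proper.
Qed.

(** If [y] lay outside the component of [x], a [k.-1]-colouring of G - y on that component and one
    of G - x elsewhere would together colour G. *)
Lemma critical_connected (x y : G) : connect (@adj G) x y.
Proof.
apply/negPn/negP=> nxy.
have [f [f_lt f_proper]] := critical_del_coloring x.
have [g [g_lt g_proper]] := critical_del_coloring y.
pose h z := if connect (@adj G) x z then g z else f z.
case: (@critical_no_coloring h) => [u v uv|u]; last first.
  rewrite /h; case: ifP => xu; first by apply: g_lt; apply: contraNneq nxy => <-.
  by apply: f_lt; apply: contraFneq xu => ->; apply: connect0.
have vu : adj v u by rewrite adj_sym.
rewrite /h; have -> : connect (@adj G) x v = connect (@adj G) x u.
  by apply/idP/idP => [|] xu; apply: connect_trans xu _; apply: connect1.
case: ifP => xu.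
  apply: g_proper => //; apply: contraNneq nxy => <- //.
  by apply: connect_trans xu _; apply: connect1.
apply: f_proper => //; apply: contraFneq xu => <-; first exact: connect0.
exact: connect1.
Qed.

End Critical.

Lemma pigeonhole (T C : finType) (f : T -> C) (A : {set T}) m :
  #|C| * m < #|A| -> exists c, m < #|[set x in A | f x == c]|.
Proof.
move=> lt_A; apply/existsP; apply: contraLR lt_A => /existsPn fib_le.
rewrite -leqNgt -sum1_card (partition_big f predT) //= -sum_nat_const.
apply: leq_sum => c _; apply: leq_trans (_ : _ <= #|[set x in A | f x == c]|) _.
  by rewrite -sum1_card; apply: eq_leq; apply: eq_bigl => x; rewrite inE.
by rewrite leqNgt fib_le.
Qed.

(** * Traces on an independent set, and distances *)

Section Free.
Variables (k : nat) (G : sgraph) (col : G -> 'I_k).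
Hypotheses (col_proper : proper col).
Hypotheses (noP5 : P5_avoiding G) (no_cricket : cricket_avoiding G).

Lemma same_col_nonadj x y : col x = col y -> ~~ adj x y.
Proof. by move=> cxy; apply/negP=> /col_proper; rewrite cxy eqxx. Qed.

(** Otherwise [a], [t], [s], [u], [b] would induce a P5. Thus traces of nonadjacent [t] and [u] that
    share [s] are nested. *)
Lemma nested_or_disjoint (S : {set G}) s t u a b :
  {in S &, forall x y, ~~ adj x y} -> s \in S -> a \in S -> b \in S ->
  adj t s -> adj u s -> ~~ adj t u ->
  adj t a -> ~~ adj u a -> adj u b -> adj t b.
Proof.
move=> S_ind sS aS bS ts us /negbTE ntu ta /negbTE nua ub.
apply: contraTT isT => /negbTE ntb.
have st : adj s u by rewrite adj_sym.
have at' : adj a t by rewrite adj_sym.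
move: (noP5 at' ts st ub); rewrite ntu ntb (adj_sym a u) nua.
by rewrite !(negbTE (S_ind _ _ _ _)).
Qed.

(** A neighbour [t] of [s] with smallest trace works: the vertices [u x], for [x] other than [s] in
    this trace, form a clique and so get distinct colours. *)
Lemma small_trace (S : {set G}) s :
  {in S &, forall x y, ~~ adj x y} ->
  {in S, forall a, a != s -> exists2 z, adj s z & ~~ adj a z} ->
  s \in S -> 1 < #|S| ->
  exists2 t, adj s t & #|[set x in S | adj t x]| <= k.+1.
Proof.
move=> S_ind S_inc sS S_gt1.
have [a aS] : exists2 a, a \in S & a != s.
  case/card_gt1P: S_gt1 => x [y [xS yS xy]].
  by have [<-|] := eqVneq x s; [exists y; rewrite // eq_sym|exists x].
case/(S_inc a aS) => t0 st0 _.
pose tr t := [set x in S | adj t x].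
case: (arg_minnP (fun t => #|tr t|) st0) => t st t_min; exists t => //.
pose u a := odflt s [pick z | adj s z && ~~ adj a z].
have uP x : x \in S -> x != s -> adj s (u x) /\ ~~ adj x (u x).
  move=> xS xs; rewrite /u; case: pickP => [z /andP[] //|no_z].
  by have [z sz xz] := S_inc x xS xs; have := no_z z; rewrite sz xz.
(* If [t] and [u x] were nonadjacent, their traces would be nested at [s]; since [u x] misses [x],
   its trace would be strictly smaller, against the choice of [t]. *)
have tu x : x \in tr t :\ s -> adj t (u x).
  rewrite !inE => /and3P[xs xS tx]; have [su xu] := uP x xS xs.
  have [y yu yt] : exists2 y, y \in tr (u x) & y \notin tr t.
    apply/subsetPn; apply/negP=> sub.
    have /eqP eq_tr : tr (u x) == tr t by rewrite eqEcard sub t_min.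
    have : x \in tr (u x) by rewrite eq_tr !inE xS.
    by rewrite !inE xS adj_sym (negbTE xu).
  move: yu yt; rewrite !inE => /andP[yS uy]; rewrite yS /=.
  apply: contraNT => ntu.
  by apply: (@nested_or_disjoint S s t (u x) x y) => //; rewrite adj_sym.
(* Otherwise [t; s, u x; x, y] is a cricket. *)
have u_adj x y : x \in tr t :\ s -> y \in tr t :\ s -> x != y -> adj (u x) y.
  move=> xT yT; move: (xT) (yT); rewrite !inE.
  move=> /and3P[xs xS tx] /and3P[ys yS ty] xy.
  have [su xu] := uP x xS xs.
  have ts : adj t s by rewrite adj_sym.
  have := no_cricket ts (tu _ xT) su tx ty xy.
  rewrite (negbTE (S_ind s x sS xS)) (negbTE (S_ind s y sS yS)).
  by rewrite (negbTE (S_ind x y xS yS)) (adj_sym _ x) (negbTE xu) orbF.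
have u_clique x y : x \in tr t :\ s -> y \in tr t :\ s -> x != y ->
    adj (u x) (u y).
  move=> xT yT xy; move: (xT) (yT); rewrite !inE.
  move=> /and3P[xs xS tx] /and3P[ys yS ty].
  have [sux xu] := uP x xS xs; have [suy yu] := uP y yS ys.
  (* Each of [u x] and [u y] sees the vertex missed by the other, so their traces, which share [s],
     are not nested. *)
  apply: contraNT xu => nuxy; rewrite adj_sym.
  apply: (@nested_or_disjoint S s (u x) (u y) y x) => //.
  - by rewrite adj_sym.
  - by rewrite adj_sym.
  - exact: u_adj.
  - by rewrite adj_sym.
  - by apply: u_adj => //; rewrite eq_sym.
(* In the bound [k.+1], the extra 1 counts [s] itself. *)
rewrite (cardsD1 s) -add1n; apply: leq_add; first exact: leq_b1.
have col_inj : {in tr t :\ s &, injective (col \o u)}.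
  move=> x y xT yT /= /same_col_nonadj; apply: contraNeq.
  exact: u_clique.
by rewrite -(card_in_imset col_inj) -[leqRHS]card_ord max_card.
Qed.

(* Greedy choice: take [s] whose trace is largest and discard that trace; by
   maximality the remaining traces are disjoint from it. *)
Lemma private_subset (t : G -> G) d (U : {set G}) :
  {in U &, forall x y, ~~ adj x y} -> {in U, forall x, adj x (t x)} ->
  {in U &, forall x y, ~~ adj (t x) (t y)} ->
  {in U, forall x, #|[set y in U | adj (t x) y]| <= d} ->
  exists J : {set G}, [/\ J \subset U, #|U| <= d * #|J|
    & {in J &, forall x y, adj x (t y) = (x == y)}].
Proof.
elim/ltn_ind: {U}_.+1 {-2}U (ltnSn #|U|) => // n IHn U ltUn U_ind xt t_ind t_d.
have [->|[x0 x0U]] := set_0Vmem U.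
  by exists set0; split; rewrite ?sub0set ?cards0 // => x y; rewrite inE.
pose tr x := [set y in U | adj (t x) y].
case: (arg_maxnP (fun x => #|tr x|) x0U) => s /= sU s_max; have {}sU : s \in U by [].
have ts : adj (t s) s by rewrite adj_sym xt.
have sub : U :\: tr s \subset U by apply: subsetDl.
have sW := subsetP sub.
have trU : tr s \subset U by apply/subsetP=> x; rewrite inE => /andP[].
have cardU : #|U| = #|tr s| + #|U :\: tr s|.
  by rewrite -(cardsID (tr s) U) (setIidPr trU).
have tr_gt0 : 0 < #|tr s| by apply/card_gt0P; exists s; rewrite /tr !inE sU ts.
have ltU' : #|U :\: tr s| < #|U| by rewrite cardU -{1}[#|_ :\: _|]add0n ltn_add2r.
have [J [JU cardJ JP]] : exists J : {set G}, [/\ J \subset U :\: tr s,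
    #|U :\: tr s| <= d * #|J| & {in J &, forall x y, adj x (t y) = (x == y)}].
  apply: (IHn #|U| ltUn _ ltU' (sub_in2 sW U_ind) (sub_in1 sW xt)
    (sub_in2 sW t_ind)).
  move=> x xU; apply: leq_trans (t_d x (sW x xU)); apply: subset_leq_card.
  by apply/subsetP=> y; rewrite !inE => /andP[/andP[_ ->]].
have sJ : s \notin J.
  by apply/negP=> /(subsetP JU); rewrite /tr !inE sU ts.
have sJF x : x \in J -> [/\ x \in U, ~~ adj x (t s) & ~~ adj s (t x)].
  move=> /(subsetP JU); rewrite /tr !inE => /andP[+ xU]; rewrite xU /= => tsx.
  split=> //; first by rewrite adj_sym.
  (* If [t x] saw [s], its trace would be nested with [tr s]; containing [x], it would be strictly
     larger. *)
  apply/negP=> stx; have := s_max x xU; rewrite leqNgt => /negP; apply.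
  apply: proper_card; apply/properP; split.
    apply/subsetP=> y; rewrite !inE => /andP[yU tsy]; rewrite yU /=.
    apply/negPn/negP=> txy; have txs : adj (t x) s by rewrite adj_sym.
    have txx : adj (t x) x by rewrite adj_sym xt.
    move/negP: tsx; apply.
    exact: (@nested_or_disjoint U s (t s) (t x) y x) (t_ind s x sU xU) _ _ _.
  by exists x; rewrite !inE xU // adj_sym xt.
exists (s |: J); split.
- by rewrite subUset sub1set sU (subset_trans JU).
- rewrite cardU cardsU1 sJ mulnDr muln1; apply: leq_add => //.
  exact: t_d.
- move=> x y; rewrite !inE => /predU1P[->|xJ] /predU1P[->|yJ].
  + by rewrite xt // eqxx.
  + have [_ _ /negbTE ->] := sJF y yJ; symmetry; apply: contraNF sJ.
    by move=> /eqP ->.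
  + have [_ /negbTE -> _] := sJF x xJ; symmetry; apply: contraNF sJ.
    by move=> /eqP <-.
  + exact: JP.
Qed.

(** Induction along a walk: if one more step led to distance 4, the path [x], [a], [b], [last x p],
    [z] would be an induced P5. *)
Lemma connect_dist3 (x y : G) : connect (@adj G) x y ->
  [\/ x = y, adj x y, exists2 w, adj x w & adj w y
    | exists p q, [/\ adj x p, adj p q & adj q y]].
Proof.
case/connectP=> p; elim/last_ind: p y => [|p z IHp] y.
  by move=> _ ->; constructor 1.
rewrite rcons_path last_rcons => /andP[xp yz] ->{y}.
have [<-|xz] := eqVneq x z; first by constructor 1.
have [axz|naxz] := boolP (adj x z); first by constructor 2.
have [/existsP[w /andP[xw wz]]|/existsPn now] :=
    boolP [exists w, adj x w && adj w z]; first by constructor 3; exists w.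
have no_w w : adj x w -> adj w z = false.
  by move=> xw; have := now w; rewrite xw => /negbTE.
case: (IHp _ xp erefl) => [xy|xy|[w xw wy]|[a [b [xa ab yb]]]].
- by rewrite -xy (negbTE naxz) in yz.
- by constructor 3; exists (last x p).
- by constructor 4; exists w, (last x p).
have [xb|nxb] := boolP (adj x b); first by constructor 4; exists b, (last x p).
have [xy|nxy] := boolP (adj x (last x p)).
  by constructor 3; exists (last x p).
have [ay|nay] := boolP (adj a (last x p)).
  by constructor 4; exists a, (last x p).
have [bz|nbz] := boolP (adj b z); first by constructor 4; exists a, b.
have := noP5 xa ab yb yz.
by rewrite !(negbTE nxb, negbTE nxy, negbTE naxz, negbTE nay, negbTE nbz) no_w.
Qed.

(** * Bounding an induced matching *)

Section Matching.
Variables (J : {set G}) (t : G -> G).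
Hypothesis J_ind : {in J &, forall x y, ~~ adj x y}.
Hypothesis t_ind : {in J &, forall x y, ~~ adj (t x) (t y)}.
Hypothesis J_t : {in J &, forall x y, adj x (t y) = (x == y)}.

Let e x (b : bool) := if b then t x else x.

Lemma endpoint_adj x y b c : x \in J -> y \in J ->
  adj (e x b) (e y c) = (x == y) && (b != c).
Proof.
move=> xJ yJ; case: b c => [] [] /=; rewrite ?andbF ?andbT.
- by rewrite (negbTE (t_ind xJ yJ)).
- by rewrite adj_sym J_t // eq_sym.
- by rewrite J_t.
- by rewrite (negbTE (J_ind xJ yJ)).
Qed.

(* The matching edge at [x] joins [e x false = x] to [e x true = t x]. *)
Definition touches w x := [exists b, adj w (e x b)].
Definition covers w x := [forall b, adj w (e x b)].

(** If [w] saw just one end of each edge, the two edges joined through [w] would form an induced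
    P5. *)
Lemma touches_two w x y : x \in J -> y \in J -> x != y ->
  touches w x -> touches w y -> covers w x || covers w y.
Proof.
move=> xJ yJ xy /existsP[b wb] /existsP[c wc].
rewrite -[_ || _]negbK negb_or !negb_forall.
apply/negP=> /andP[/existsP[b' nb'] /existsP[c' nc']].
have bb' : b' != b by apply: contraNneq nb' => ->.
have cc' : c' != c by apply: contraNneq nc' => ->.
have xbb : adj (e x b') (e x b) by rewrite endpoint_adj // eqxx.
have ycc : adj (e y c) (e y c') by rewrite endpoint_adj // eqxx eq_sym.
rewrite adj_sym in wb.
have := noP5 xbb wb wc ycc.
rewrite !endpoint_adj // (negbTE xy) !andFb (negbTE nc').
by rewrite adj_sym (negbTE nb').
Qed.

(** The covered edge makes a triangle with [w]; touched ends of two further edges would be the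
    pendant vertices of a cricket centred at [w]. *)
Lemma covers_touches_two w x y z : x \in J -> y \in J -> z \in J ->
  x != y -> x != z -> y != z ->
  covers w x -> touches w y -> ~~ touches w z.
Proof.
move=> xJ yJ zJ xy xz yz /forallP wx /existsP[b wb].
apply/existsP=> -[c wc].
have ex : adj (e x true) (e x false) by rewrite endpoint_adj // eqxx.
have byz : e y b != e z c.
  have: adj (e y b) (e y (~~ b)) by rewrite endpoint_adj // eqxx; case: b {wb}.
  by apply: contraTneq => ->; rewrite endpoint_adj // eq_sym (negbTE yz).
have := no_cricket (wx true) (wx false) ex wb wc byz.
by rewrite !endpoint_adj // (negbTE xy) (negbTE xz) (negbTE yz).
Qed.

Lemma touches_three w x y z : x \in J -> y \in J -> z \in J ->
  x != y -> x != z -> y != z ->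
  touches w x -> touches w y -> ~~ touches w z.
Proof.
move=> xJ yJ zJ xy xz yz wx wy.
case/orP: (touches_two xJ yJ xy wx wy) => full.
  exact: (@covers_touches_two w x y z).
by apply: (@covers_touches_two w y x z) => //; rewrite eq_sym.
Qed.

Lemma card_other_touched w x (A : {set G}) : x \in J -> touches w x ->
  A \subset J :\ x -> #|[set y in A | touches w y]| <= 1.
Proof.
move=> xJ wx /subsetP AJ; apply/card_le1_eqP=> y z.
rewrite !inE => /andP[yA wy] /andP[zA].
move: (AJ y yA) (AJ z zA); rewrite !inE => /andP[yx yJ] /andP[zx zJ].
apply: contraTeq => yz.
by apply: (@touches_three w x y z) => //; rewrite eq_sym.
Qed.

(** Each [x] gets a vertex [w x] touching both edges, sorted by its colour and by whether it sees
    [t x0]. Two of them in one class would be nonadjacent with a common neighbour on the edge at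
    [x0], giving a P5 that ends on the edges at [x] and [y]. *)
Lemma card_common_touched x0 : x0 \in J ->
  #|[set x in J :\ x0 | [exists w, touches w x0 && touches w x]]| <= 2 * k.
Proof.
move=> x0J; set A := [set x in _ | _].
pose w x := odflt x0 [pick w | touches w x0 && touches w x].
have wP x : x \in A -> [/\ x \in J, x0 != x, touches (w x) x0 & touches (w x) x].
  rewrite !inE eq_sym => /andP[/andP[xx0 xJ] /existsP[z zP]].
  rewrite /w; case: pickP => [w' /andP[] //|no_w].
  by have := no_w z; rewrite zP.
have card_CB : #|{: 'I_k * bool}| = 2 * k by rewrite card_prod card_ord card_bool mulnC.
rewrite leqNgt -card_CB -[X in X < _]muln1; apply/negP=> big.
have [[c b]] := pigeonhole (fun x => (col (w x), adj (w x) (e x0 true))) big.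
case/card_gt1P=> x [y [xC yC xy]]; move: xC yC.
move=> /setIdP[xA /eqP[cx bx]] /setIdP[yA /eqP[cy by_]].
have [xJ x0x wx0 wx] := wP x xA; have [yJ x0y wy0 wy] := wP y yA.
have nxy : ~~ adj (w x) (w y) by apply: same_col_nonadj; rewrite cx cy.
have nwx : ~~ touches (w x) y.
  by apply: (@touches_three _ x0 x y).
have nwy : ~~ touches (w y) x.
  by apply: (@touches_three _ x0 y x) => //; rewrite eq_sym.
(* Both see [t x0], or neither does and both see [x0], as both touch this edge. *)
have [d [xd yd]] : exists d, adj (w x) (e x0 d) /\ adj (w y) (e x0 d).
  have [bT|bF] := boolP b; first by exists true; rewrite bx by_ bT.
  exists false; move: wx0 wy0 => /existsP[[] d1] /existsP[[] d2] //; move: bF.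
  - by rewrite -bx d1.
  - by rewrite -bx d1.
  - by rewrite -by_ d2.
case/existsP: wx => b1 wx; case/existsP: wy => b2 wy.
have xdx : adj (e x b1) (w x) by rewrite adj_sym.
have dy : adj (e x0 d) (w y) by rewrite adj_sym.
have := noP5 xdx xd dy wy.
rewrite !endpoint_adj // (negbTE xy) (negbTE nxy) [x == x0]eq_sym (negbTE x0x).
rewrite (negbTE x0y) /= orbF => /orP[xy'|xy'].
- by move/existsP: nwy; apply; exists b1; rewrite adj_sym.
- by move/existsP: nwx; apply; exists b2.
Qed.

(* Otherwise an end of the edge at [x] missed by [q], the other end, [q], [p]
   and an end of the edge at [x0] touched by [p] form a P5. *)
Lemma covers_far p q x0 x : x0 \in J -> x \in J -> x0 != x ->
  (forall w, touches w x0 -> ~~ touches w x) ->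
  touches p x0 -> touches q x -> adj p q -> covers q x.
Proof.
move=> x0J xJ x0x far px0 qx pq.
have npx c : adj (e x c) p = false.
  apply/negbTE; apply: contra (far p px0) => px.
  by apply/existsP; exists c; rewrite adj_sym.
have nqx0 c : adj q (e x0 c) = false.
  by apply: contraTF qx => qx0; apply: far; apply/existsP; exists c.
case/existsP: qx => b qb; case/existsP: px0 => c pc.
apply: contraT; rewrite negb_forall => /existsP[b' nqb'].
have bb' : b' != b by apply: contraNneq nqb' => ->.
have xbb : adj (e x b') (e x b) by rewrite endpoint_adj // eqxx.
have bq : adj (e x b) q by rewrite adj_sym.
have qp : adj q p by rewrite adj_sym.
have := noP5 xbb bq qp pc.
rewrite !npx nqx0 !endpoint_adj // [x == x0]eq_sym (negbTE x0x).
by rewrite (adj_sym _ q) (negbTE nqb').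
Qed.

(** These [x] are at distance 3 from [x0], along a path [x0], [p], [q], [x] where [p] covers the
    edge at [x0] and [q] the edge at [x]. At most three of them can have their chosen [q] in the
    same colour. *)
Lemma card_far_touched x0 : x0 \in J ->
  {in J, forall x, connect (@adj G) x0 x} ->
  #|[set x in J :\ x0 | ~~ [exists w, touches w x0 && touches w x]]| <= k * 3.
Proof.
move=> x0J J_conn; set A := [set x in _ | _].
have AP x : x \in A -> [/\ x \in J, x0 != x &
    forall w, touches w x0 -> ~~ touches w x].
  rewrite !inE eq_sym => /andP[/andP[x0x xJ] /existsPn no_w]; split=> // w w0.
  by have := no_w w; rewrite w0.
pose P x pq := [&& covers pq.1 x0, adj pq.1 pq.2 & covers pq.2 x].
have far x : x \in A -> exists pq, P x pq.
  move=> /AP[xJ x0x no_w].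
  have touch0 y z : adj y z -> touches z y.
    by move=> yz; apply/existsP; exists false; rewrite adj_sym.
  case: (connect_dist3 (J_conn x xJ)) => [xx|x0x'|[w x0w wx]|[p [q [x0p pq qx]]]].
  - by rewrite xx eqxx in x0x.
  - by have := J_ind x0J xJ; rewrite x0x'.
  - by rewrite adj_sym in wx; have /negP[] := no_w w (touch0 _ _ x0w); apply: touch0.
  rewrite adj_sym in qx; have px0 := touch0 _ _ x0p; have qx' := touch0 _ _ qx.
  exists (p, q); rewrite /P /= pq (covers_far x0J xJ x0x no_w px0 qx' pq) !andbT.
  apply: (covers_far xJ x0J _ _ qx' px0); rewrite 1?eq_sym 1?adj_sym //.
  by move=> w; apply: contraL => /no_w.
pose pq x := odflt (x0, x0) [pick pq | P x pq].
have pqP x : x \in A -> P x (pq x).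
  by move=> /far [z zP]; rewrite /pq; case: pickP => [//|/(_ z)]; rewrite zP.
rewrite leqNgt -{1}[k]card_ord; apply/negP=> big.
have [c] := pigeonhole (fun x => col (pq x).2) big; set B := [set x in A | _] => B_gt3.
have /card_gt0P[x xB] : 0 < #|B| by apply: leq_trans B_gt3.
case: (setIdP xB) => xA /eqP cx; have [xJ x0x no_x] := AP x xA.
case/and3P: (pqP x xA) => px0 pqx qx.
have BJ : B \subset J by apply/subsetP=> y /setIdP[/AP[]].
have tch w y : covers w y -> touches w y.
  by move=> /forallP wy; apply/existsP; exists true.
have touch_p : #|[set y in B :\ x | touches (pq x).1 y]| <= 1.
  apply: (card_other_touched x0J (tch _ _ px0)).
  apply/subsetP=> y /setD1P[_ /setIdP[/AP[yJ x0y _] _]].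
  by rewrite !inE eq_sym x0y.
have touch_q : #|[set y in B :\ x | touches (pq x).2 y]| <= 1.
  by apply: (card_other_touched xJ (tch _ _ qx)); apply: setSD.
(* Besides [x], at least three edges remain in [B]; the [p] and [q] of [x] touch at most one each,
   so some edge at [y] avoids both. *)
have /subsetPn[y] : ~~ (B :\ x \subset [set y in B :\ x | touches (pq x).1 y]
    :|: [set y in B :\ x | touches (pq x).2 y]).
  apply/negP=> /subset_leq_card; apply/negP; rewrite -ltnNge.
  rewrite (cardsD1 x) xB ltnS in B_gt3.
  apply: leq_ltn_trans (leq_card_setU _ _) _.
  exact: leq_ltn_trans (leq_add touch_p touch_q) B_gt3.
move=> yBx; rewrite in_setU => /norP[npy nqy]; have /setD1P[yx yB] := yBx.
have {}npy : ~~ touches (pq x).1 y by apply: contra npy => xy; apply/setIdP.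
have {}nqy : ~~ touches (pq x).2 y by apply: contra nqy => xy; apply/setIdP.
case: (setIdP yB) => yA /eqP cy; have [yJ x0y no_y] := AP y yA.
case/and3P: (pqP y yA) => py0 pqy qy.
have qq : ~~ adj (pq x).2 (pq y).2 by apply: same_col_nonadj; rewrite cx cy.
have neq_q : (pq x).2 != (pq y).2.
  by apply: contraNneq nqy => ->; apply: tch.
have ntouch w z b : ~~ touches w z -> adj w (e z b) = false.
  by move=> nwz; apply: contraNF nwz => wz; apply/existsP; exists b.
have nqx0 b : adj (pq x).2 (e x0 b) = false.
  by apply: ntouch; apply: contraTN (tch _ _ qx); apply: no_x.
have nqy0 b : adj (pq y).2 (e x0 b) = false.
  by apply: ntouch; apply: contraTN (tch _ _ qy); apply: no_y.
have ee : adj (e x0 true) (e x0 false) by rewrite endpoint_adj // eqxx.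
have [pxt pxf] := (forallP px0 true, forallP px0 false).
have [pyt pyf] := (forallP py0 true, forallP py0 false).
(* Otherwise the [p] of [x], the edge at [x0] and both [q] would form a cricket; the next claim is
   symmetric. *)
have npxqy : ~~ adj (pq x).1 (pq y).2.
  apply/negP=> pxqy; have := no_cricket pxt pxf ee pqx pxqy neq_q.
  by rewrite !(adj_sym (e _ _)) !nqx0 !nqy0 (negbTE qq).
have npyqx : ~~ adj (pq y).1 (pq x).2.
  apply/negP=> pyqx; have := no_cricket pyt pyf ee pyqx pqy neq_q.
  by rewrite !(adj_sym (e _ _)) !nqx0 !nqy0 (negbTE qq).
have qpy : adj (pq y).2 (pq y).1 by rewrite adj_sym.
have qpx : adj (pq x).2 (pq x).1 by rewrite adj_sym.
(* Adjacent [p] give a P5 from [t y] through the [q] and [p] of [y] to the [p] and [q] of [x];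
   nonadjacent ones give a P5 between the two [q] through [t x0]. *)
have [ppxy|nppxy] := boolP (adj (pq y).1 (pq x).1).
  have yq : adj (e y true) (pq y).2 by rewrite adj_sym (forallP qy).
  have := noP5 yq qpy ppxy pqx.
  rewrite !(adj_sym (e _ _)) (ntouch _ y) ?no_y ?tch // (ntouch _ y) //.
  rewrite (ntouch _ y) // (adj_sym (pq y).2) (negbTE npxqy).
  by rewrite (adj_sym (pq y).2) (negbTE qq) (negbTE npyqx).
have xp : adj (e x0 true) (pq x).1 by rewrite adj_sym.
have := noP5 qpy pyt xp pqx.
rewrite nqy0 (adj_sym (pq y).2) (negbTE npxqy) (adj_sym (pq y).2) (negbTE qq).
by rewrite (negbTE nppxy) (negbTE npyqx) adj_sym nqx0.
Qed.

Lemma card_matching : {in J &, forall x y, connect (@adj G) x y} ->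
  #|J| <= (5 * k).+1.
Proof.
move=> J_conn; have [->|[x0 x0J]] := set_0Vmem J; first by rewrite cards0.
(* The count is 1 for [x0], [2 * k] for edges sharing a touching vertex with it, and [3 * k] for the
   others. *)
rewrite (cardsD1 x0) x0J add1n ltnS.
rewrite -(cardsID [set x | [exists w, touches w x0 && touches w x]]) (_ : 5 = 2 + 3) //.
rewrite mulnDl; apply: leq_add.
  apply: leq_trans (card_common_touched x0J).
  by apply/subset_leq_card/subsetP=> x; rewrite !inE.
rewrite [3 * k]mulnC; apply: leq_trans (card_far_touched x0J _); last first.
  by move=> x xJ; apply: J_conn.
by apply/subset_leq_card/subsetP=> x; rewrite !inE => /andP[-> ->].
Qed.

End Matching.

(** The factors are [k] for the colour of the vertex, [k] for the colour of its chosen partner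
    [t s], [k.+1] for the size of a trace, and [(5 * k).+1] for the matching. *)
Lemma critical_bound : (forall x y : G, x != y -> exists2 z, adj x z & ~~ adj y z) ->
  (forall x y : G, connect (@adj G) x y) ->
  #|G| <= k * (k * (k.+1 * (5 * k).+1)).
Proof.
move=> G_inc G_conn; set b := k.+1 * _; rewrite leqNgt; apply/negP=> big.
rewrite -cardsT -{1}[k]card_ord in big.
have [c] := pigeonhole col big; set S := [set x in _ | _] => S_big.
have S_ind : {in S &, forall x y, ~~ adj x y}.
  move=> x y; rewrite !inE => /eqP cx /eqP cy; apply: same_col_nonadj.
  by rewrite cx cy.
have k_gt0 : 0 < k by apply: leq_ltn_trans (ltn_ord c).
have S_gt1 : 1 < #|S| by apply: leq_ltn_trans S_big; rewrite !muln_gt0 k_gt0.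
pose P s t := adj s t && (#|[set x in S | adj t x]| <= k.+1).
pose t s := odflt s [pick t | P s t].
have tP s : s \in S -> P s (t s).
  move=> sS; rewrite /t; case: pickP => // no_t.
  have [|u su u_le] := small_trace S_ind _ sS S_gt1.
    by move=> a aS as_; apply: G_inc; rewrite eq_sym.
  by have := no_t u; rewrite /P su u_le.
rewrite -{1}[k]card_ord in S_big.
(* Partners of one colour are pairwise nonadjacent, as an induced matching requires. *)
have [c'] := pigeonhole (col \o t) S_big; set U := [set x in _ | _] => U_big.
have US : {subset U <= S} by move=> x /setIdP[].
have t_ind : {in U &, forall x y, ~~ adj (t x) (t y)}.
  move=> x y /setIdP[_ /eqP cx] /setIdP[_ /eqP cy].
  by apply: same_col_nonadj; rewrite [LHS]cx.
have [||J [JU UJ J_t]] := private_subset (sub_in2 US S_ind) _ t_ind (d := k.+1).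
- by move=> x /US/tP/andP[].
- move=> x /US/tP/andP[_]; apply: leq_trans; apply: subset_leq_card.
  by apply/subsetP=> y /setIdP[/US yS xy]; rewrite in_set yS.
have JS := subsetP JU.
have := card_matching (sub_in2 JS (sub_in2 US S_ind)) (sub_in2 JS t_ind) J_t
  (fun x y _ _ => G_conn x y).
by rewrite leqNgt -(ltn_pmul2l (ltn0Sn k)) (leq_trans U_big UJ).
Qed.

End Free.

(** The representatives are indexed by all Boolean matrices of order at most [n]; [edge_list_graph]
    symmetrises them and drops loops, so each one gives a graph. *)
Lemma finitely_many_bounded (P : sgraph -> Prop) n :
  (forall G, P G -> #|G| <= n) -> finitely_many_up_to_iso P.
Proof.
move=> P_le; pose T : finType := {m : 'I_n.+1 & {ffun 'I_m * 'I_m -> bool}}.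
pose es (u : T) := [seq (val p.1, val p.2) | p <- enum [pred p | tagged u p]].
pose H (u : T) := edge_list_graph (tag u : 'I_n.+1) (es u).
exists #|T|, (fun i => H (enum_val i)).
move=> G /P_le; rewrite -ltnS => G_lt.
pose f : {ffun 'I_#|G| * 'I_#|G| -> bool} :=
  [ffun p => adj (enum_val p.1 : G) (enum_val p.2)].
pose u : T := Tagged (fun m : 'I_n.+1 => {ffun 'I_m * 'I_m -> bool})
  (f : {ffun 'I_(Ordinal G_lt) * 'I_(Ordinal G_lt) -> bool}).
exists (enum_rank u); rewrite enum_rankK.
exists (@enum_rank G); first exact: enum_rank_bij.
move=> x y; rewrite /= /edge_list_adj (inj_eq enum_rank_inj).
have esE (i j : 'I_#|G|) : ((val i, val j) \in es u) = adj (enum_val i : G) (enum_val j).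
  have val2_inj : injective (fun p : 'I_#|G| * 'I_#|G| => (val p.1, val p.2)).
    by case=> [i1 j1] [i2 j2] [/val_inj -> /val_inj ->].
  rewrite -[(_, _)]/((fun p => (val p.1, val p.2)) (i, j)) (mem_map val2_inj).
  by rewrite mem_enum inE /= ffunE.
rewrite !esE !enum_rankK [adj y x]adj_sym orbb.
by case: eqVneq => // ->; rewrite adj_irrefl.
Qed.

Theorem theorem7 (k : nat) (hk : 1 <= k) :
  finitely_many_up_to_iso
    (fun G : sgraph => vertex_critical k G /\ free2 P5 cricket G).
Proof.
apply: (@finitely_many_bounded _ (k * (k * (k.+1 * (5 * k).+1)))).
move=> G [Gcrit [/P5_avoidingP noP5 /cricket_avoidingP no_cricket]].
have [col col_proper] := critical_coloring Gcrit.
apply: (critical_bound col_proper noP5 no_cricket).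
  exact: critical_incomparable hk Gcrit.
exact: critical_connected hk Gcrit.
Qed.
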